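(* Let $Y$ be a finite-dimensional subspace of the real Banach space $c_0$. Then $Y$ has property-$(HB)$ in $c_0$ if and only if $Y$ has property-$(U)$ in $c_0$ and there exists a bi-contractive projection $P:c_0\to Y$ onto $Y$ such that both $Y$ and $(I-P)(c_0)$ are $L_1$-predual spaces.
   Context: For a closed subspace $Y$ of a Banach space $X$, $Y^\perp=\{x^*\in X^*: x^*(y)=0\ \forall y\in Y\}$. $Y$ has property-$(U)$ in $X$ if every bounded linear functional on $Y$ has a unique norm-preserving extension to $X$. $Y$ has property-$(HB)$ in $X$ if there is a closed subspace $G$ of $X^*$ with $X^*=G\oplus Y^\perp$ such that for each $x^*\in X^*$, $\|x^*\|>\|y^\#\|$ and $\|x^*\|\ge\|y^\perp\|$ whenever $x^*=y^\#+y^\perp$ with $y^\#\in G$ and $0\ne y^\perp\in Y^\perp$. A linear projection $P$ is bi-contractive if $\|P\|\le1$ and $\|I-P\|\le 1$. A Banach space is an $L_1$-predual if its dual is isometric to $L_1(\mu)$ for some measure space $(\Omega,\Sigma,\mu)$. *)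

(* Defs.v *)
From HB Require Import structures.
From mathcomp Require Import all_boot all_order all_algebra.
From mathcomp Require Import all_classical all_reals all_analysis.

Set Implicit Arguments.
Unset Strict Implicit.
Unset Printing Implicit Defensive.
Import Order.TTheory GRing.Theory Num.Theory.
Import numFieldNormedType.Exports.
Local Open Scope classical_set_scope.
Local Open Scope ring_scope.

Section bounded_operators.
Context (R : realType) (V W : normedModType R).

Definition blin_pred : {pred V -> W} :=
  [pred f | `[< linear f /\ bounded_fun_norm f >]].

Lemma blin_predP (f : V -> W) :
  reflect (linear f /\ bounded_fun_norm f) (f \in blin_pred).
Proof. exact: asboolP. Qed.

Lemma blin_submod_closed : submod_closed blin_pred.
Proof.
split.
  apply/blin_predP; split => [a x y|r]; first by rewrite /= scaler0 addr0.
  by exists 0 => x _; rewrite normr0.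
move=> a f g /blin_predP[lf bf] /blin_predP[lg bg]; apply/blin_predP; split.
  move=> k x y.
  rewrite [LHS]/= [RHS]/= !fctE lf lg !scalerDr !scalerA (mulrC k a).
  by rewrite addrACA.
move=> r; have [Mf fM] := bf r; have [Mg gM] := bg r.
exists (`|a| * Mf + Mg) => x xr.
rewrite !fctE (le_trans (ler_normD _ _))// lerD ?gM// normrZ.
by rewrite ler_wpM2l ?fM.
Qed.

HB.instance Definition _ :=
  GRing.isSubmodClosed.Build R (V -> W) blin_pred blin_submod_closed.

Record blin : Type := Blin {
  blin_fun :> V -> W;
  blin_funP : blin_fun \in blin_pred }.

HB.instance Definition _ := [isSub for blin_fun].
HB.instance Definition _ := [Choice of blin by <:].
HB.instance Definition _ := [SubChoice_isSubLmodule of blin by <:].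

Lemma blin_linear (f : blin) : linear f.
Proof. by have /blin_predP[] := valP f. Qed.

HB.instance Definition _ (f : blin) :=
  GRing.isLinear.Build R V W *:%R (blin_fun f) (@blin_linear f).

Lemma blin_bounded (f : blin) : bounded_fun_norm f.
Proof. by have /blin_predP[] := valP f. Qed.

Lemma blin_ext (f g : blin) : f =1 g -> f = g.
Proof. by move=> fg; apply/val_inj/funext. Qed.

(* [sup] is 0 on sets without a supremum; [has_sup_opnorm] below shows that
   this never happens here. *)
Definition opnorm (f : blin) : R := sup [set `|f x| | x in [set x | `|x| <= 1]].

Lemma has_sup_opnorm (f : blin) :
  has_sup [set `|f x| | x in [set x | `|x| <= 1]].
Proof.
split; first by exists `|f 0|, 0; rewrite //= normr0.
by have [M fM] := blin_bounded f 1; exists M => _ [x /= x1 <-]; exact: fM.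
Qed.

Lemma opnorm_unit_ub (f : blin) x : `|x| <= 1 -> `|f x| <= opnorm f.
Proof.
move=> x1; apply: sup_upper_bound; first exact: has_sup_opnorm.
by exists x.
Qed.

Lemma opnorm_le (f : blin) M :
  (forall x, `|x| <= 1 -> `|f x| <= M) -> opnorm f <= M.
Proof.
move=> fM; apply: ge_sup; first by have [] := has_sup_opnorm f.
by move=> _ [x /= x1 <-]; exact: fM.
Qed.

Lemma opnorm_ge0 (f : blin) : 0 <= opnorm f.
Proof. by rewrite (le_trans (normr_ge0 (f 0)))// opnorm_unit_ub ?normr0. Qed.

Lemma opnorm_ub (f : blin) x : `|f x| <= opnorm f * `|x|.
Proof.
have [->|x0] := eqVneq x 0; first by rewrite linear0 !normr0 mulr0.
have nx0 : 0 < `|x| by rewrite normr_gt0.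
rewrite -ler_pdivrMr//.
have := @opnorm_unit_ub f (`|x|^-1 *: x).
rewrite linearZ/= !normrZ normfV normr_id mulVf ?gt_eqF// lexx mulrC.
exact.
Qed.

Lemma opnormD (f g : blin) : opnorm (f + g) <= opnorm f + opnorm g.
Proof.
apply: opnorm_le => x x1; rewrite (le_trans (ler_normD _ _))//.
by rewrite lerD ?opnorm_unit_ub.
Qed.

Let opnormZ_le (a : R) (f : blin) : opnorm (a *: f) <= `|a| * opnorm f.
Proof.
apply: opnorm_le => x x1; rewrite [`|_|](_ : _ = `|a *: f x|)// normrZ.
by rewrite ler_wpM2l ?opnorm_unit_ub.
Qed.

Lemma opnormZ (a : R) (f : blin) : opnorm (a *: f) = `|a| * opnorm f.
Proof.
apply/eqP; rewrite eq_le opnormZ_le/=.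
have [->|a0] := eqVneq a 0; first by rewrite normr0 mul0r opnorm_ge0.
have := opnormZ_le a^-1 (a *: f).
by rewrite scalerA mulVf// scale1r normfV ler_pdivlMl ?normr_gt0.
Qed.

Lemma opnorm_eq0 (f : blin) : opnorm f = 0 -> f = 0.
Proof.
move=> f0; apply: blin_ext => x; apply/eqP.
by rewrite -normr_le0 (le_trans (opnorm_ub _ _))// f0 mul0r.
Qed.

HB.instance Definition _ :=
  Lmodule_isNormed.Build R blin opnormD opnormZ opnorm_eq0.

Lemma blin_normE (f : blin) : `|f| = opnorm f.
Proof. by []. Qed.

Definition brange_pred (f : blin) : {pred W} := [pred y | `[< range f y >]].

Lemma brange_submod_closed (f : blin) : submod_closed (brange_pred f).
Proof.
split; first by apply/asboolP; exists 0 => //; rewrite linear0.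
move=> a _ _ /asboolP[x _ <-] /asboolP[y _ <-]; apply/asboolP.
by exists (a *: x + y) => //; rewrite linearP.
Qed.

HB.instance Definition _ (f : blin) :=
  GRing.isSubmodClosed.Build R W (brange_pred f) (brange_submod_closed f).

Definition brange (f : blin) : submodClosed W := brange_pred f.

End bounded_operators.
Arguments blin {R}.
Arguments blin_pred {R}.

Definition dual (R : realType) (X : normedModType R) : normedModType R :=
  blin X R^o.

Section identity_operator.
Context (R : realType) (X : normedModType R).

Lemma blin_id_subproof : (id : X -> X) \in blin_pred X X.
Proof. by apply/blin_predP; split => // r; exists r. Qed.

Definition blin_id : blin X X := Blin blin_id_subproof.

End identity_operator.

Section subspaces.
Context (R : realType) (X : normedModType R).

Definition subspace_of (Y : submodClosed X) : Type := {x : X | x \in Y}.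

Section structure.
Variable Y : submodClosed X.
HB.instance Definition _ := SubChoice.on (subspace_of Y).
HB.instance Definition _ := [SubChoice_isSubLmodule of subspace_of Y by <:].

Let subnorm (y : subspace_of Y) : R := `|val y|.

Let subnormD x y : subnorm (x + y) <= subnorm x + subnorm y.
Proof. exact: ler_normD. Qed.

Let subnormZ a x : subnorm (a *: x) = `|a| * subnorm x.
Proof. exact: normrZ. Qed.

Let subnorm_eq0 x : subnorm x = 0 -> x = 0.
Proof. by move=> /normr0_eq0 x0; exact/val_inj. Qed.

HB.instance Definition _ :=
  Lmodule_isNormed.Build R (subspace_of Y) subnormD subnormZ subnorm_eq0.

Lemma subspace_normE (y : subspace_of Y) : `|y| = `|val y|.
Proof. by []. Qed.

End structure.

Definition finite_dimensional (Y : submodClosed X) :=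
  exists n (b : 'I_n -> X), forall x,
    x \in Y <-> exists c : 'I_n -> R, x = \sum_(i < n) c i *: b i.

Definition annihilator (Y : submodClosed X) : set (dual X) :=
  [set f | forall y, y \in Y -> f y = 0].

Definition property_U (Y : submodClosed X) :=
  forall g : dual (subspace_of Y),
    exists! f : dual X, (forall y, f (val y) = g y) /\ `|f| = `|g|.

Definition property_HB (Y : submodClosed X) :=
  exists G : submodClosed (dual X),
    [/\ closed [set` G],
        forall f : dual X, exists! gh : dual X * dual X,
          [/\ gh.1 \in G, annihilator Y gh.2 & f = gh.1 + gh.2] &
        forall f g h : dual X,
          g \in G -> annihilator Y h -> h != 0 -> f = g + h ->
          `|g| < `|f| /\ `|h| <= `|f|].

Definition projection_onto (P : blin X X) (Y : submodClosed X) :=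
  (forall x, P (P x) = P x) /\ range P = [set` Y].

Definition bicontractive (P : blin X X) := `|P| <= 1 /\ `|blin_id X - P| <= 1.

End subspaces.

Section L1_predual.
Local Open Scope ereal_scope.

(* [J] is a linear isometry of [V] onto L1(mu). [LspaceType1 mu] is the library's type of a.e. classes of real functions of
   finite 1-norm; as it carries no module structure, linearity of [J] is stated
   on representatives, up to a.e. equality. *)
Definition isometric_to_L1 (R : realType) (V : normedModType R)
    d (T : measurableType d) (mu : {measure set T -> \bar R}) :=
  exists J : V -> LspaceType1 mu,
    [/\ bijective J,
        forall (a : R) (u v : V),
          ae_eq mu setT (J (a *: u + v)%R : T -> R)
                        (fun t => a * (J u t : R) + (J v t : R))%R &
        forall u : V, 'N[mu]_1 [EFin \o (J u : T -> R)] = (`|u|%R)%:E].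

Definition L1_predual (R : realType) (X : normedModType R) :=
  exists d (T : measurableType d) (mu : {measure set T -> \bar R}),
    isometric_to_L1 (dual X) mu.

End L1_predual.

Section c0_space.
Context (R : realType).

Definition c0_pred : {pred nat -> R} :=
  [pred u | `[< u @ \oo --> (0 : R) >]].

Lemma c0_predP (u : nat -> R) : reflect (u @ \oo --> (0 : R)) (u \in c0_pred).
Proof. exact: asboolP. Qed.

Lemma c0_submod_closed : submod_closed (c0_pred : {pred (nat -> R^o)}).
Proof.
split; first by apply/c0_predP; exact: cvg_cst.
move=> a u v /c0_predP u0 /c0_predP v0; apply/c0_predP.
have := cvgD (cvgM (cvg_cst a) u0) v0; rewrite mulr0 addr0; exact.
Qed.

HB.instance Definition _ :=
  GRing.isSubmodClosed.Build R (nat -> R^o) c0_pred c0_submod_closed.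

Record c0 : Type := C0 { c0_fun :> nat -> R^o; c0_funP : c0_fun \in c0_pred }.

HB.instance Definition _ := [isSub for c0_fun].
HB.instance Definition _ := [Choice of c0 by <:].
HB.instance Definition _ := [SubChoice_isSubLmodule of c0 by <:].

(* A genuine supremum, by [c0_has_sup]. *)
Definition c0_norm (u : c0) : R := sup (range (fun n => `|u n|)).

Lemma c0_cvg (u : c0) : u @ \oo --> (0 : R).
Proof. by have /c0_predP := valP u. Qed.

Lemma c0_has_sup (u : c0) : has_sup (range (fun n => `|u n|)).
Proof.
split; first by exists `|u 0%N|, 0%N.
have [M [_ uM]] : [bounded u n | n in setT].
  by apply: cvg_seq_bounded; apply/cvg_ex; exists 0; exact: c0_cvg.
by exists (M + 1) => _ [n _ <-]; apply: uM => //; rewrite ltrDl.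
Qed.

Lemma c0_norm_ub (u : c0) n : `|u n| <= c0_norm u.
Proof. by apply: sup_upper_bound; [exact: c0_has_sup|exists n]. Qed.

Lemma c0_norm_le (u : c0) M : (forall n, `|u n| <= M) -> c0_norm u <= M.
Proof.
move=> uM; apply: ge_sup; first by have [] := c0_has_sup u.
by move=> _ [n _ <-].
Qed.

Lemma c0_norm_ge0 (u : c0) : 0 <= c0_norm u.
Proof. exact: le_trans (c0_norm_ub u 0). Qed.

Lemma c0_normD (u v : c0) : c0_norm (u + v) <= c0_norm u + c0_norm v.
Proof.
apply: c0_norm_le => n; rewrite (le_trans (ler_normD _ _))//.
by rewrite lerD ?c0_norm_ub.
Qed.

Let c0_normZ_le (a : R) (u : c0) : c0_norm (a *: u) <= `|a| * c0_norm u.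
Proof.
apply: c0_norm_le => n; rewrite [`|_|](_ : _ = `|a * u n|)// normrM.
by rewrite ler_wpM2l ?c0_norm_ub.
Qed.

Lemma c0_normZ (a : R) (u : c0) : c0_norm (a *: u) = `|a| * c0_norm u.
Proof.
apply/eqP; rewrite eq_le c0_normZ_le/=.
have [->|a0] := eqVneq a 0; first by rewrite normr0 mul0r c0_norm_ge0.
have := c0_normZ_le a^-1 (a *: u).
by rewrite scalerA mulVf// scale1r normfV ler_pdivlMl ?normr_gt0.
Qed.

Lemma c0_norm_eq0 (u : c0) : c0_norm u = 0 -> u = 0.
Proof.
move=> u0; apply/val_inj/funext => n; apply/eqP.
by rewrite -normr_le0 -u0 c0_norm_ub.
Qed.

HB.instance Definition _ :=
  Lmodule_isNormed.Build R c0 c0_normD c0_normZ c0_norm_eq0.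

Lemma c0_normE (u : c0) : `|u| = c0_norm u.
Proof. by []. Qed.

Lemma c0_complete (F : set_system c0) : ProperFilter F -> cauchy F -> cvg F.
Proof.
move=> FF /cauchyP Fc.
have coordB (x y : c0) n : `|x n - y n| <= `|x - y|.
  by rewrite c0_normE (le_trans _ (c0_norm_ub _ n)).
pose ev n (u : c0) : R := u n.
have coord_cvg n : cvg (ev n @ F).
  apply: cauchy_cvg; apply: (cauchy_exP (fmap _ F)) => e e0.
  have [x Fx] := Fc e e0; exists (x n).
  change (F (ev n @^-1` ball (x n) e)); apply: filterS Fx => u.
  by rewrite /= -!ball_normE/= => xu; rewrite (le_lt_trans (coordB _ _ _)).
pose l n : R^o := lim (ev n @ F).
have coord_lim n : ev n @ F --> l n by exact: coord_cvg.
have l_close e x : 0 < e -> F (ball x e) -> forall n, `|x n - l n| <= e.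
  move=> e0 Fx n; apply/ler_addgt0Pr => d d0.
  have /cvgrPdist_lt/(_ _ d0) Fd := coord_lim n.
  have [u /= [xu lu]] := filter_ex (filterI Fx Fd).
  rewrite -ball_normE/= in xu.
  rewrite -(subrKA (u n : R)) (le_trans (ler_normD _ _))// lerD//.
    by rewrite (le_trans (coordB _ _ _))// ltW.
  by rewrite distrC ltW.
have lc0 : l \in c0_pred.
  apply/c0_predP/cvgrPdist_lt => e e0.
  have e20 : 0 < e / 2 by rewrite divr_gt0.
  have [x Fx] := Fc _ e20.
  have /cvgrPdist_lt/(_ _ e20) := c0_cvg x.
  apply: filterS => n /=; rewrite !sub0r !normrN => xn.
  rewrite -(subrK (x n : R) (l n)) (le_lt_trans (ler_normD _ _))//.
  by rewrite [ltRHS]splitr ler_ltD// distrC l_close.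
apply/cvg_ex; exists (C0 lc0); apply/cvgrPdist_le => e e0.
have e20 : 0 < e / 2 by rewrite divr_gt0.
have [x Fx] := Fc _ e20.
apply: filterS (Fx) => u; rewrite -ball_normE/= => xu.
rewrite c0_normE; apply: c0_norm_le => n.
rewrite [`|_|](_ : _ = `|l n - u n|)//.
rewrite -(subrKA (x n : R)) (le_trans (ler_normD _ _))//.
rewrite [leRHS]splitr lerD//; first by rewrite distrC l_close.
by rewrite (le_trans (coordB _ _ _))// ltW.
Qed.

HB.instance Definition _ := Uniform_isComplete.Build c0 c0_complete.
HB.instance Definition _ := CompleteNormedModule.on c0.

End c0_space.

(* Main.v *)
From HB Require Import structures.
Require Import Defs.
From mathcomp Require Import all_boot all_order all_algebra.
From mathcomp Require Import all_classical all_reals all_analysis.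
From mathcomp Require Import measurable_realfun lra.
Set Implicit Arguments.
Unset Strict Implicit.
Unset Printing Implicit Defensive.
Import Order.TTheory GRing.Theory Num.Theory.
Import numFieldNormedType.Exports.
Local Open Scope classical_set_scope.
Local Open Scope ring_scope.

(** Both directions compare property HB with a projection [P] onto [Y] through
the adjoint [f |-> f \o P] on the dual: its range is the complement [G] of the
annihilator, and the [G]-component of [f] is [f \o P].

From right to left ([property_U_bicontractive_HB]), take for [G] the
functionals fixed by the adjoint.  The two weak norm inequalities say that [P]
and [I - P] are contractions.  If [|f \o P| = |f|], then [f] and [f \o P] are
two norm-preserving extensions of the restriction of [f] to [Y], so they agree
by property U; this gives the strict inequality.

From left to right, write the identity of [Y] as a finite sum of rank one maps
[y |-> phi y *: b] with [phi] a functional on the whole space and [b] in [Y].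
Replacing each [phi] by its [G]-component does not change it on [Y] and yields a
projection [P] whose adjoint has range in [G] ([HB_projection]).  The norm
conditions of property HB then bound the adjoints of [P] and [I - P], hence [P]
and [I - P] themselves, since the sup norm is attained on coordinate
functionals.  Composition with [P] extends functionals from [Y] without
increasing the norm, and the strict inequality makes that extension unique
([HB_property_U]).

That the ranges of [P] and [I - P] are L1-preduals follows from a rigidity
property: when [P] and [I - P] are contractive projections of the space of null
sequences, every diagonal entry of the matrix of [P] is 0, 1 or 1/2, and
[2 P - I] is an involution permuting the coordinates up to sign
([bicontractive_rows]).  A sequence in the range of [P] is thus determined, with
its norm, by one coordinate from each orbit that the range does not annihilate,
so the range is an isometric copy of null sequences on a set [A] of integers
([bicontractive_range_L1_predual]).  Its dual is the space of summable families
on [A], realised as the L1 space of the counting measure on [A]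
([c0_copy_L1_predual]). *)

(** * Bounded operators and adjoints *)

Lemma bounded_in_blin_pred (R : realType) (V W : normedModType R)
    (f : V -> W) (M : R) :
  linear f -> (forall x, `|f x| <= M * `|x|) -> f \in blin_pred V W.
Proof.
move=> lf fM; apply/blin_predP; split => // r; exists (`|M| * `|r|) => x xr.
rewrite (le_trans (fM x))// (le_trans (ler_wpM2r _ (ler_norm M)))//.
by rewrite ler_wpM2l// (le_trans xr)// ler_norm.
Qed.

Lemma dualZ (R : realType) (V : normedModType R) (f : dual V) (a : R) (x : V) :
  f (a *: x) = a * f x.
Proof. by rewrite linearZ. Qed.

(** Continuity of a functional in the form used below: a vector is replaced by
a finite combination of basis vectors at a controlled cost. *)
Lemma dual_approx (R : realType) (V : normedModType R) (f : dual V) (e : R) :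
  0 < e -> exists2 d, 0 < d & forall x u, `|x - u| <= d -> `|f x - f u| <= e.
Proof.
move=> e0; have c_gt0 : 0 < `|f| + 1 by rewrite ltr_wpDl.
exists (e / (`|f| + 1)) => [|x u xu]; first exact: divr_gt0.
rewrite -linearB (le_trans (opnorm_ub _ _))// -blin_normE.
rewrite (le_trans (ler_wpM2l _ xu))//.
by rewrite mulrCA ger_pMr// ler_pdivrMr// mul1r lerDl.
Qed.

Lemma contraction_in_blin_pred (R : realType) (V W : normedModType R)
    (f : {linear V -> W}) :
  (forall x, `|f x| <= `|x|) -> (f : V -> W) \in blin_pred V W.
Proof.
move=> f1; apply: (@bounded_in_blin_pred _ _ _ _ 1) => [|x].
  exact: linearP.
by rewrite mul1r.
Qed.

Section composition.
Context (R : realType) (U V W : normedModType R).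

Lemma blin_comp_subproof (f : blin V W) (g : blin U V) :
  f \o g \in blin_pred U W.
Proof.
apply: (@bounded_in_blin_pred _ _ _ _ (`|f| * `|g|)) => [a x y|x] /=.
  by rewrite !linearP.
rewrite (le_trans (opnorm_ub _ _))// -mulrA -blin_normE ler_wpM2l//.
exact: opnorm_ub.
Qed.

Definition blin_comp (f : blin V W) (g : blin U V) : blin U W :=
  Blin (blin_comp_subproof f g).

Lemma blin_compE f g x : blin_comp f g x = f (g x). Proof. by []. Qed.

Lemma blin_comp_norm (f : blin V W) (g : blin U V) :
  `|blin_comp f g| <= `|f| * `|g|.
Proof.
rewrite [leLHS]blin_normE; apply: opnorm_le => x x1.
rewrite blin_compE (le_trans (opnorm_ub _ _))// -blin_normE ler_wpM2l//.
exact: opnorm_unit_ub.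
Qed.

End composition.

Section adjoint_operator.
Context (R : realType) (X : normedModType R) (P : blin X X).

Definition adjoint (f : dual X) : dual X := blin_comp f P.

Lemma adjointE f x : adjoint f x = f (P x). Proof. by []. Qed.

Lemma adjoint_linear : linear adjoint.
Proof. by move=> a f g; apply: blin_ext. Qed.

HB.instance Definition _ :=
  GRing.isLinear.Build R (dual X) (dual X) *:%R adjoint adjoint_linear.

Lemma adjoint_norm f : `|adjoint f| <= `|f| * `|P|.
Proof. exact: blin_comp_norm. Qed.

End adjoint_operator.

(** * The unit vector basis of the space of null sequences *)

Section c0_basis.
Context (R : realType).
Implicit Types (u v : c0 R).

Lemma c0_ext u v : u =1 v -> u = v.
Proof. by move=> uv; apply/val_inj/funext. Qed.

Lemma c0D u v n : (u + v) n = u n + v n. Proof. by []. Qed.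
Lemma c0B u v n : (u - v) n = u n - v n. Proof. by []. Qed.
Lemma c0Z a u n : (a *: u) n = a * u n. Proof. by []. Qed.

Lemma c0_sum (I : Type) (r : seq I) (P : pred I) (F : I -> c0 R) n :
  (\sum_(i <- r | P i) F i) n = \sum_(i <- r | P i) F i n.
Proof.
by elim/big_rec2: _ => // i x u _ <-.
Qed.

Lemma c0_coord_le u n : `|u n| <= `|u|.
Proof. exact: c0_norm_ub. Qed.

Lemma c0_unit_subproof (n : nat) : (fun k => (k == n)%:R : R^o) \in @c0_pred R.
Proof.
apply/c0_predP; apply: cvg_near_cst; near=> k.
by rewrite gtn_eqF//; near: k; exists n.+1.
Unshelve. all: by end_near. Qed.

Definition c0_unit n : c0 R := C0 (c0_unit_subproof n).

Lemma c0_unitE n k : c0_unit n k = (k == n)%:R. Proof. by []. Qed.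

Lemma c0_mask_subproof (A : {pred nat}) u :
  (fun n => if n \in A then u n else 0) \in @c0_pred R.
Proof.
apply/c0_predP/cvgrPdist_le => e e0.
have /cvgrPdist_le/(_ e e0) := @c0_cvg R u.
apply: filterS => n; rewrite !sub0r !normrN; case: ifP => // _ _.
by rewrite normr0 ltW.
Qed.

Definition c0_mask A u : c0 R := C0 (c0_mask_subproof A u).

Lemma c0_maskE A u n : c0_mask A u n = if n \in A then u n else 0.
Proof. by []. Qed.

Lemma c0_mask_linear A : linear (c0_mask A).
Proof.
move=> a u v; apply: c0_ext => n; rewrite c0D c0Z !c0_maskE c0D c0Z.
by case: ifP => // _; rewrite mulr0 addr0.
Qed.

HB.instance Definition _ A := GRing.isLinear.Build R (c0 R) (c0 R) *:%R
  (c0_mask A) (c0_mask_linear A).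

(** Unit vectors span a dense subspace: beyond some index all coordinates are
small, and truncation leaves only those. *)
Lemma c0_truncation u (e : R) : 0 < e ->
  exists n, `|u - \sum_(k < n) u k *: c0_unit k| <= e.
Proof.
move=> e0; have /cvgrPdist_le/(_ e e0) [n _ nu] := @c0_cvg R u.
exists n; rewrite c0_normE; apply: c0_norm_le => k; rewrite c0B c0_sum.
under eq_bigr do rewrite c0Z c0_unitE.
have [kn|nk] := ltnP k n.
  rewrite (bigD1 (Ordinal kn))//= eqxx mulr1 big1 ?addr0 ?subrr ?normr0 ?ltW//.
  move=> i ik; rewrite [_ == _]negbTE ?mulr0//.
  by apply: contra ik => /eqP ki; apply/eqP/val_inj.
rewrite big1 => [|i _]; first by have := nu k nk; rewrite sub0r normrN subr0.
by rewrite gtn_eqF ?mulr0// (leq_trans _ nk).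
Qed.

Lemma c0_functional_eq0 (f : dual (c0 R)) :
  (forall n, f (c0_unit n) = 0) -> f = 0.
Proof.
move=> f0; apply: blin_ext => u; apply/eqP; rewrite -normr_le0.
apply/ler_addgt0Pr => e e0; rewrite add0r.
have [d d0 fd] := dual_approx f e0; have [n /fd] := c0_truncation u d0.
rewrite linear_sum big1 ?subr0// => k _.
by rewrite linearZ/= f0 scaler0.
Qed.

Lemma c0_coord_subproof n : (fun u : c0 R => u n) \in blin_pred (c0 R) R^o.
Proof.
apply: (@bounded_in_blin_pred _ _ _ _ 1) => [a u v //|u].
by rewrite mul1r; exact: c0_coord_le.
Qed.

Definition c0_coord n : dual (c0 R) := Blin (c0_coord_subproof n).

Lemma c0_coord_norm n : `|c0_coord n| <= 1.
Proof.
rewrite blin_normE; apply: opnorm_le => u u1.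
exact: le_trans (c0_coord_le _ _) u1.
Qed.

End c0_basis.

(** Contractivity passes from the adjoint back to the operator because the norm
of [P x] is the supremum of the values at [x] of the functionals
[adjoint P (c0_coord R n)]. *)
Lemma adjoint_contraction (R : realType) (P : blin (c0 R) (c0 R)) :
  (forall f : dual (c0 R), `|adjoint P f| <= `|f|) ->
  forall x, `|P x| <= `|x|.
Proof.
move=> Pf x; rewrite c0_normE; apply: c0_norm_le => n.
rewrite -[P x n]/(adjoint P (c0_coord R n) x) (le_trans (opnorm_ub _ _))//.
by rewrite ler_piMl// (le_trans (Pf _))// c0_coord_norm.
Qed.

(** * The L1 space of a sum of unit point masses *)

Section atomic_L1.
Context (R : realType) (A : {pred nat}).
Local Open Scope ereal_scope.

(** Null summands keep the index set equal to the whole of [nat], so that a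
finite and an infinite [A] are treated alike. *)
Definition atom (n : nat) : {measure set nat -> \bar R} :=
  if n \in A then [the {measure set nat -> \bar R} of dirac n]
  else [the {measure set nat -> \bar R} of mzero].

Definition atomic_measure : {measure set nat -> \bar R} :=
  [the {measure set nat -> \bar R} of mseries atom 0].

Lemma integral_atomic_measure (h : nat -> \bar R) : (forall n, 0 <= h n) ->
  \int[atomic_measure]_n h n = \sum_(n <oo | n \in A) h n.
Proof.
move=> h0; rewrite ge0_integral_measure_series//.
rewrite [RHS]eseries_mkcond; apply: eq_eseriesr => n _; rewrite /atom.
case: ifP => _; rewrite ?integral_measure_zero//.
by rewrite integral_dirac// diracT mul1e.
Qed.

Lemma Lnorm1_atomic_measure (h : nat -> R) :
  'N[atomic_measure]_1[EFin \o h] = \sum_(n <oo | n \in A) `|h n|%:E.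
Proof. by rewrite Lnorm1 integral_atomic_measure. Qed.

Lemma ae_eq_atomic_measure (h k : nat -> R) :
  ae_eq atomic_measure setT h k <-> {in A, h =1 k}.
Proof.
split=> [[N [_ N0 hkN]] n nA|hk].
  apply: contrapT => hkn.
  have Nn : N n by apply: hkN => /(_ I).
  (* A set that meets [A] contains an atom, so its measure is at least 1. *)
  suff : 1 <= atomic_measure N by rewrite N0 leNgt lte01.
  rewrite /atomic_measure/= /mseries (@nneseriesD1 _ _ n)//.
  rewrite [X in X + _](_ : _ = 1); first by rewrite leeDl// nneseries_ge0.
  by rewrite /atom nA/= diracE mem_set.
exists (~` [set` A]); split => //; last first.
  by move=> n /= hkn nA; apply: hkn => _; exact: hk.
rewrite /atomic_measure/= /mseries eseries0// => n _ _; rewrite /atom.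
case: ifP => [nA|//]; rewrite /= diracE memNset//= => /(_ nA).
Qed.

End atomic_L1.

Section L1_classes.
Context (R : realType) d (T : measurableType d) (mu : {measure set T -> \bar R}).

(** An element of the quotient carries a proof that its norm is finite; proof
irrelevance reduces equality to that of the underlying classes. *)
Lemma LspaceType1_eq (u v : LspaceType1 mu) : ae_eq mu setT u v -> u = v.
Proof.
case: u v => [u [[fu]]] [v [[fv]]] /= uv.
have uvE : u = v.
  rewrite -[u]reprK -[v]reprK; apply/eqP; rewrite eqmodE; apply/asboolP.
  exact: uv.
by move: fv; rewrite -uvE => fv; rewrite (Prop_irrelevance fu fv).
Qed.

Lemma Lnorm1_ae_eq (h k : T -> R) : measurable_fun setT h ->
  measurable_fun setT k -> ae_eq mu setT h k ->
  ('N[mu]_1[EFin \o h] = 'N[mu]_1[EFin \o k])%E.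
Proof.
move=> mh mk hk; rewrite !Lnorm1; apply: ae_eq_integral => //.
- by apply: measurableT_comp => //; exact/measurable_EFinP.
- by apply: measurableT_comp => //; exact/measurable_EFinP.
- by apply: filterS hk => x /= /[apply] ->.
Qed.

(** The class of [h] has a representative chosen by the quotient, possibly
different from [h]; its norm is finite because the norm ignores null sets. *)
Lemma LspaceType1_exists (h : T -> R) : measurable_fun setT h ->
  ('N[mu]_1[EFin \o h] < +oo)%E -> exists u : LspaceType1 mu, ae_eq mu setT u h.
Proof.
move=> mh hfin.
pose m : {mfun T >-> measurableTypeR R} :=
  @mfun_Sub _ _ T (measurableTypeR R) h (mem_set mh).
pose q : {mfun_ mu, T >-> measurableTypeR R} := (\pi m)%qT.
have qh : ae_eq mu setT (q : T -> R) h.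
  have /eqP := reprK q.
  by rewrite eqmodE => /asboolP.
have qfin : finite_norm mu 1 q.
  have mq : measurable_fun setT (q : T -> R).
    exact: (@measurable_funPT _ _ _ _ (repr q)).
  by rewrite /finite_norm (Lnorm1_ae_eq mq mh qh).
pose u : LspaceType1 mu :=
  HB.pack q (isFinLebesgue.Build _ _ _ mu 1%E (lexx _) q qfin).
by exists u.
Qed.

End L1_classes.

(** * Duals of isometric copies of null-sequence spaces *)

(** [T] identifies [V] with a space of null sequences supported in [A] that
contains all the unit vectors of [A]; [b n] corresponds to the [n]-th one.
Since such vectors span a dense subspace, a functional on [V] amounts to the
summable family of its values on [b]. *)
Section c0_copies.
Context (R : realType) (V : normedModType R) (A : {pred nat}).
Variables (T : {linear V -> c0 R}) (b : nat -> V).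
Hypothesis isoT : forall x, `|T x| = `|x|.
Hypothesis suppT : forall x n, n \notin A -> T x n = 0.
Hypothesis Tb : forall n, n \in A -> T (b n) = c0_unit R n.

Lemma copy_truncation (x : V) (e : R) : 0 < e ->
  exists n, `|x - \sum_(k < n | (k : nat) \in A) T x k *: b k| <= e.
Proof.
move=> /(c0_truncation (T x)) [n xn]; exists n.
rewrite -isoT linearB/= linear_sum/= big_mkcond/=.
rewrite [X in _ - X](_ : _ = \sum_(k < n) T x k *: c0_unit R k)//.
apply: eq_bigr => k _; case: ifPn => [kA|kA]; last by rewrite suppT// scale0r.
by rewrite linearZZ Tb.
Qed.

Lemma copy_functional_approx (f : dual V) (x : V) (e : R) : 0 < e ->
  exists n, `|f x - \sum_(k < n | (k : nat) \in A) T x k * f (b k)| <= e.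
Proof.
move=> /(dual_approx f)[d d0 fd].
have [n /fd fn] := copy_truncation x d0; exists n; move: fn.
by rewrite linear_sum; under eq_bigr do rewrite linearZ.
Qed.

Lemma copy_sign_sum (s : nat -> R) n : (forall k, `|s k| <= 1) ->
  `|\sum_(k < n | (k : nat) \in A) s k *: b k| <= 1.
Proof.
move=> s1; rewrite -isoT c0_normE; apply: c0_norm_le => m.
rewrite linear_sum c0_sum.
have [mn|nm] := ltnP m n; last first.
  rewrite big1 ?normr0// => k kA; rewrite linearZZ Tb// c0Z c0_unitE.
  by rewrite gtn_eqF ?mulr0// (leq_trans _ nm).
rewrite big_mkcond/= (bigD1 (Ordinal mn))//= big1 => [|k km].
  rewrite addr0; case: ifP => mA; last by rewrite normr0.
  by rewrite linearZZ Tb// c0Z c0_unitE eqxx mulr1.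
case: ifP => // kA; rewrite linearZZ Tb// c0Z c0_unitE [_ == _]negbTE ?mulr0//.
by apply: contra km => /eqP ki; apply/eqP/val_inj.
Qed.

(** The sum is at most the norm of [f], as one sees by evaluating [f] on
combinations of the [b k] with coefficients the signs of [f (b k)]; it is at
least the norm because every vector is approximated by combinations with
coefficients of modulus at most its norm. *)
Lemma copy_dual_norm (f : dual V) :
  (\sum_(n <oo | n \in A) `|f (b n)|%:E = `|f|%:E)%E.
Proof.
have sums n : (\sum_(0 <= k < n | k \in A) `|f (b k)|%:E =
    (\sum_(k < n | (k : nat) \in A) `|f (b k)|)%:E)%E.
  by rewrite big_mkord sumEFin.
apply/eqP; rewrite eq_le; apply/andP; split.
  apply: lime_le; first by apply: is_cvg_nneseries => *; rewrite lee_fin.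
  apply: nearW => n; rewrite sums lee_fin.
  have := opnorm_unit_ub f (@copy_sign_sum (fun k => Num.sg (f (b k))) n _).
  rewrite linear_sum/=; under eq_bigr do rewrite dualZ -normrEsg.
  rewrite ger0_norm ?sumr_ge0// -blin_normE; apply=> k.
  by rewrite normr_sg; case: (_ == _).
set S := (\sum_(_ <oo | _) _)%E.
have S0 : (0 <= S)%E by apply: nneseries_ge0 => *; rewrite lee_fin.
case ES: S S0 => [r| |]//; rewrite ?leey// !lee_fin => r0.
rewrite blin_normE; apply: opnorm_le => x x1; apply/ler_addgt0Pr => e e0.
have [n fn] := copy_functional_approx f x e0.
rewrite -(subrK (\sum_(k < n | (k : nat) \in A) T x k * f (b k)) (f x)).
rewrite addrC (le_trans (ler_normD _ _))// lerD//.
rewrite (le_trans (ler_norm_sum _ _ _))//.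
rewrite (@le_trans _ _ (\sum_(k < n | (k : nat) \in A) `|f (b k)|))//.
  apply: ler_sum => k _; rewrite normrM ler_piMl//.
  by rewrite (le_trans (c0_coord_le _ _))// isoT.
by rewrite -lee_fin -sums -ES nneseries_lim_ge// => *; rewrite lee_fin.
Qed.

Lemma copy_functional_inj (f g : dual V) :
  {in A, forall n, f (b n) = g (b n)} -> f = g.
Proof.
move=> fg; apply/eqP; rewrite -subr_eq0 -normr_eq0 -eqe -copy_dual_norm.
rewrite eseries0// => n _ nA.
by rewrite [(f - g) (b n)](_ : _ = f (b n) - g (b n))// fg// subrr normr0.
Qed.

(** The functional is the series [x |-> \sum_n h n * T x n], absolutely
convergent since [T x] is bounded by the norm of [x]. *)
Lemma copy_functional (h : nat -> R) :
  (\sum_(n <oo | n \in A) `|h n|%:E < +oo)%E ->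
  exists f : dual V, {in A, forall n, f (b n) = h n}.
Proof.
set S := (\sum_(_ <oo | _) _)%E => hfin.
have S0 : (0 <= S)%E by apply: nneseries_ge0 => *; rewrite lee_fin.
have SE : S = (fine S)%:E by rewrite fineK// ge0_fin_numE.
pose g n : R := if n \in A then h n else 0.
have g_le n : series (fun k => `|g k|) n <= fine S.
  rewrite -lee_fin -SE (le_trans _ (nneseries_lim_ge n _)) => [||k _ _]//.
  rewrite big_mkcond/= -sumEFin lee_sum// => k _; rewrite /g.
  by case: ifP; rewrite ?normr0.
have gcvg : cvgn (series (fun n => `|g n|)).
  apply: nondecreasing_is_cvgn; last by exists (fine S) => _ [n _ <-].
  by apply: nondecreasing_series => n _ _.
pose s x := series (fun n => g n * T x n).
have s_le x n : `|s x n| <= fine S * `|x|.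
  rewrite (le_trans (ler_norm_sum _ _ _))//.
  rewrite (le_trans _ (ler_wpM2r _ (g_le n)))//.
  rewrite mulr_suml ler_sum// => k _; rewrite normrM ler_wpM2l//.
  by rewrite -isoT c0_coord_le.
have scvg x : cvgn (s x).
  apply: normed_cvg.
  apply: (@series_le_cvg _ _ (fun n => `|x| * `|g n|)) => [|n|n|].
  - by move=> n /=.
  - by rewrite mulr_ge0.
  - by rewrite /= normrM mulrC ler_wpM2r// -isoT c0_coord_le.
  - exact: is_cvg_seriesZ.
pose f (x : V) : R^o := limn (s x).
have flin : linear f.
  move=> a x y; apply: cvg_lim => //.
  have -> : s (a *: x + y) = (fun n => a * s x n + s y n).
    apply/funext => n; rewrite /s /series/= mulr_sumr -big_split/=.
    by apply: eq_bigr => k _; rewrite linearD linearZZ c0D c0Z mulrDr mulrCA.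
  by apply: cvgD; [apply: cvgMr; exact: scvg|exact: scvg].
have fbnd x : `|f x| <= fine S * `|x|.
  rewrite ler_norml; apply/andP; split.
    apply: limr_ge; first exact: scvg.
    by apply: nearW => n; have /ler_normlP[] := s_le x n; rewrite lerNl.
  apply: limr_le; first exact: scvg.
  by apply: nearW => n; have /ler_normlP[] := s_le x n.
exists (Blin (bounded_in_blin_pred flin fbnd)) => n nA /=.
apply: cvg_lim => //; apply: cvg_near_cst; exists n.+1 => // m /= nm.
rewrite /s /series/= (bigD1_seq n)/= ?iota_uniq ?mem_index_iota//.
rewrite Tb// c0_unitE eqxx mulr1 big1 ?addr0 /g ?nA// => k kn.
by rewrite c0_unitE (negbTE kn) mulr0.
Qed.

(** The isometry sends a functional [f] to the class of the family [f \o b]. *)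
Lemma c0_copy_L1_predual : L1_predual V.
Proof.
exists _, nat, (atomic_measure R A).
have J_ex (f : dual V) : exists u : LspaceType1 (atomic_measure R A),
    {in A, forall n, (u : nat -> R) n = f (b n)}.
  have [||u uf] := @LspaceType1_exists R _ _ (atomic_measure R A) (f \o b).
  - by [].
  - by rewrite Lnorm1_atomic_measure copy_dual_norm ltry.
  - by exists u; apply/ae_eq_atomic_measure.
have [J JE] := choice J_ex; exists J; split.
- have K_ex (u : LspaceType1 (atomic_measure R A)) :
      exists f : dual V, {in A, forall n, f (b n) = (u : nat -> R) n}.
    apply: copy_functional; rewrite -Lnorm1_atomic_measure.
    exact: Lebesgue_finite.
  have [K KE] := choice K_ex; exists K => [f|u].
    apply: copy_functional_inj => n nA.
    by rewrite KE// JE.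
  apply: LspaceType1_eq; apply/ae_eq_atomic_measure => n nA.
  by rewrite JE// KE.
- move=> a f g; apply/ae_eq_atomic_measure => n nA.
  by rewrite !JE.
- move=> f; rewrite Lnorm1_atomic_measure -copy_dual_norm.
  by apply: eq_eseriesr => n nA; rewrite JE.
Qed.

End c0_copies.

(** * Bicontractive projections of the space of null sequences *)

(** [p i j] is the matrix entry of [P] in row [i] and column [j].  The argument
avoids infinite sums over a row: what a row does off the diagonal is controlled
by testing it on vectors vanishing at the diagonal index. *)
Section bicontractive_projections.
Context (R : realType) (P : {linear c0 R -> c0 R}).
Hypothesis PP : forall x, P (P x) = P x.
Hypothesis contrP : forall x, `|P x| <= `|x|.
Hypothesis contrIP : forall x, `|x - P x| <= `|x|.

Local Notation e := (c0_unit R).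
Local Notation p i j := (P (e j) i).
Implicit Types (i j k : nat) (v x : c0 R).

(** Adding to [v] a multiple [t] of the unit vector [e i], with either sign,
does not raise the norm above [t], since the supports are disjoint.  For
suitable signs, the [i]-th coordinates of the images under [P] and [I - P] have
modulus equal to the left-hand sides. *)
Lemma row_offdiag i v (t : R) : v i = 0 -> `|v| <= t ->
  `|P v i| + t * `|p i i| <= t /\ `|P v i| + t * `|1 - p i i| <= t.
Proof.
move=> vi0 vt; have t0 : 0 <= t by exact: le_trans vt.
pose w (s s' : R) := (s * t) *: e i + s' *: v.
have w_le s s' : `|s| <= 1 -> `|s'| <= 1 -> `|w s s'| <= t.
  move=> s1 s1'; rewrite c0_normE; apply: c0_norm_le => k.
  rewrite c0D !c0Z c0_unitE; have [->|ki] := eqVneq k i.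
    by rewrite vi0 mulr0 addr0 mulr1 normrM (ger0_norm t0) ler_piMl.
  rewrite mulr0 add0r normrM (le_trans (ler_piMl _ _))//.
  exact: le_trans (c0_coord_le _ _) vt.
have sg1 (x : R) : `|Num.sg x| <= 1 by rewrite normr_sg; case: (_ == _).
have Pw s s' : P (w s s') i = s * t * p i i + s' * P v i.
  by rewrite linearD !linearZZ c0D !c0Z.
split.
  have := le_trans (c0_coord_le _ i)
    (le_trans (contrP _) (w_le _ _ (sg1 (p i i)) (sg1 (P v i)))).
  by rewrite Pw mulrAC -!normrEsg => /(le_trans (ler_norm _)); rewrite addrC mulrC.
have := le_trans (c0_coord_le _ i)
  (le_trans (contrIP _) (w_le _ _ (sg1 (1 - p i i)) (sg1 (- P v i)))).
rewrite c0B Pw c0D !c0Z c0_unitE eqxx vi0 mulr1 mulr0 addr0.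
rewrite opprD addrA -{1}[_ * t]mulr1 -mulrBr mulrAC -normrEsg -mulrN -normrEsg.
by move=> /(le_trans (ler_norm _)); rewrite normrN addrC mulrC.
Qed.

Lemma diag_ge0_le1 i : 0 <= p i i <= 1.
Proof.
have [] := @row_offdiag i 0 1 erefl _; first by rewrite normr0.
rewrite linear0 normr0 !add0r !mul1r !ler_norml => /andP[_ p1] /andP[_ p0].
by rewrite p1 andbT; lra.
Qed.

Lemma row_offdiag_le i v (t : R) : v i = 0 -> `|v| <= t ->
  `|P v i| <= t * p i i /\ `|P v i| <= t * (1 - p i i).
Proof.
move=> vi0 vt; have [] := row_offdiag vi0 vt.
have /andP[p0 p1] := diag_ge0_le1 i.
rewrite (ger0_norm p0) [`|1 - _|]ger0_norm ?subr_ge0// => h1 h2.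
by rewrite mulrBr mulr1 in h2 *; split; lra.
Qed.

Lemma offdiag_le i j : i != j -> `|p i j| <= p i i /\ `|p i j| <= 1 - p i i.
Proof.
move=> ij; have [||] := @row_offdiag_le i (e j) 1.
- by rewrite c0_unitE (negbTE ij).
- rewrite c0_normE; apply: c0_norm_le => k; rewrite c0_unitE.
  by case: (_ == _); rewrite ?normr0 ?normr1.
by rewrite !mul1r.
Qed.

Lemma offdiag_le_half i j : i != j -> `|p i j| <= 2^-1.
Proof. by move=> /offdiag_le[]; lra. Qed.

(** The off-diagonal part of column [i]. *)
Let col i := P (e i) - p i i *: e i.

Lemma col_diag i : col i i = 0.
Proof. by rewrite c0B c0Z c0_unitE eqxx mulr1 subrr. Qed.

Lemma col_offdiag i k : k != i -> col i k = p k i.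
Proof. by move=> ki; rewrite c0B c0Z c0_unitE (negbTE ki) mulr0 subr0. Qed.

Lemma col_norm i : `|col i| <= 2^-1.
Proof.
rewrite c0_normE; apply: c0_norm_le => k; have [->|ki] := eqVneq k i.
  by rewrite col_diag normr0 invr_ge0.
by rewrite col_offdiag// offdiag_le_half.
Qed.

(** This is the diagonal entry of the identity [P \o P = P]. *)
Lemma row_col i : P (col i) i = p i i * (1 - p i i).
Proof. by rewrite linearB linearZZ PP c0B c0Z mulrBr mulr1. Qed.

(** With [a] the diagonal entry, idempotence gives
[a * (1 - a) <= a / 2] and [a * (1 - a) <= (1 - a) / 2]: the off-diagonal part
of the column has norm at most 1/2, and the row acts on it with norm at most
[a] and at most [1 - a].  Unless [a] is 0 or 1, this forces [a = 1/2]. *)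
Lemma diag_values i : [\/ p i i = 0, p i i = 1 | p i i = 2^-1].
Proof.
have [] := row_offdiag_le (col_diag i) (col_norm i); rewrite row_col.
have /andP[p0 p1] := diag_ge0_le1 i.
rewrite ger0_norm ?mulr_ge0 ?subr_ge0// => h1 h2.
have [->|pn0] := eqVneq (p i i) 0; first by constructor 1.
have [->|pn1] := eqVneq (p i i) 1; first by constructor 2.
constructor 3; apply/le_anti/andP; split.
  by move: h2; rewrite ler_pM2r// subr_gt0 lt_neqAle pn1.
by move: h1; rewrite mulrC ler_pM2r ?lt_neqAle 1?eq_sym ?pn0//; lra.
Qed.

Lemma row_trivial i : p i i * (1 - p i i) = 0 -> forall x, P x i = p i i * x i.
Proof.
move=> pi x; pose v := x - x i *: e i.
have vi : v i = 0 by rewrite c0B c0Z c0_unitE eqxx mulr1 subrr.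
have [h1 h2] := row_offdiag_le vi (lexx _).
have Pv0 : P v i = 0.
  apply/eqP; rewrite -normr_le0.
  by move/eqP: pi; rewrite mulf_eq0 => /orP[|] /eqP pi;
    [rewrite pi mulr0 in h1|rewrite pi mulr0 in h2].
have /(congr1 (fun u => P u i)) : x = v + x i *: e i by rewrite subrK.
by rewrite linearD linearZZ c0D c0Z Pv0 add0r mulrC.
Qed.

(** Otherwise the row would be half the coordinate functional, by density of the
unit vectors, and would kill [col i]; but [row_col] gives the value 1/4. *)
Lemma row_partner i : p i i = 2^-1 -> exists2 j, j != i & p i j != 0.
Proof.
move=> pi; apply: contrapT => noj.
pose Pb := Blin (contraction_in_blin_pred contrP).
pose f : dual (c0 R) := blin_comp (c0_coord R i) Pb - 2^-1 *: c0_coord R i.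
have fE x : f x = P x i - 2^-1 * x i by [].
have /c0_functional_eq0 f0 n : f (e n) = 0.
  rewrite fE c0_unitE eq_sym; have [->|ni] := eqVneq n i.
    by rewrite pi mulr1 subrr.
  rewrite mulr0 subr0; apply/eqP/negP => /negP pn; apply: noj.
  by exists n.
have := fE (col i); rewrite f0 row_col pi col_diag mulr0 subr0 => /esym/eqP.
by rewrite [_ == _]negbTE//; apply: lt0r_neq0; rewrite -[ltRHS]/(_ * _); lra.
Qed.

(** The row attains on [col i], which has norm at most 1/2, the largest value
1/4 that it can take on such vectors.  Hence raising the [j]-th coordinate of
[col i] to the extreme value of the right sign cannot increase it further, so
that coordinate already is extreme. *)
Lemma partner_sym i j : p i i = 2^-1 -> j != i -> p i j != 0 ->
  p j i = Num.sg (p i j) / 2.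
Proof.
move=> pi ji pij; pose s := Num.sg (p i j); pose v := col i.
have s1 : `|s| = 1 by rewrite normr_sg pij.
(* [col i] with its [j]-th coordinate replaced by [s / 2]. *)
pose w := v + (s / 2 - v j) *: e j.
have wi : w i = 0.
  by rewrite c0D c0Z c0_unitE eq_sym (negbTE ji) mulr0 addr0 col_diag.
have w_le : `|w| <= 2^-1.
  rewrite c0_normE; apply: c0_norm_le => k; rewrite c0D c0Z c0_unitE.
  have [->|kj] := eqVneq k j.
    by rewrite mulr1 addrC subrK normrM s1 mul1r normfV ger0_norm.
  by rewrite mulr0 addr0 (le_trans (c0_coord_le _ _))// col_norm.
have [+ _] := row_offdiag_le wi w_le.
rewrite linearD linearZZ c0D c0Z row_col pi => /(le_trans (ler_norm _)) h.
have vj : v j = p j i by exact: col_offdiag.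
have vj_le : `|v j| <= 2^-1 by rewrite vj offdiag_le_half.
have h2 : (s / 2 - v j) * p i j <= 0 by lra.
move: vj_le; rewrite -vj ler_norml => /andP[v1 v2].
move: h2; rewrite /s; have [p0|p0|/eqP] := ltgtP (p i j) 0.
- by rewrite (ltr0_sg p0) nmulr_lle0// => ?; lra.
- by rewrite (gtr0_sg p0) pmulr_lle0// => ?; lra.
- by rewrite (negbTE pij).
Qed.

Lemma partner_neq0 i j : p i i = 2^-1 -> j != i -> p i j != 0 -> p j i != 0.
Proof.
move=> pi ji pij.
by rewrite (partner_sym pi ji pij) mulf_neq0 ?invr_eq0 ?pnatr_eq0// sgr_eq0.
Qed.

Lemma partner_diag i j : p i i = 2^-1 -> j != i -> p i j != 0 -> p j j = 2^-1.
Proof.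
move=> pi ji pij; have [] := offdiag_le ji.
rewrite (partner_sym pi ji pij) normrM normr_sg pij mul1r.
by rewrite ger0_norm ?invr_ge0//; lra.
Qed.

Lemma partner_sgr i j : p i i = 2^-1 -> j != i -> p i j != 0 ->
  Num.sg (p j i) = Num.sg (p i j).
Proof.
move=> pi ji pij; rewrite (partner_sym pi ji pij) sgrM sgr_id.
by rewrite [X in _ * X]gtr0_sg ?invr_gt0// mulr1.
Qed.

(** The entries [p i i] and [p i j] are [1/2] in modulus and exhaust the norm 1
of the row, so the row vanishes on the vectors supported off [i] and [j]. *)
Lemma row_pair i j : p i i = 2^-1 -> j != i -> p i j != 0 ->
  forall x, P x i = (x i + Num.sg (p i j) * x j) / 2.
Proof.
move=> pi ji pij; set s := Num.sg (p i j).
have s1 : `|s| = 1 by rewrite normr_sg pij.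
have ij : i != j by rewrite eq_sym.
have pijE : p i j = s / 2.
  have pj := partner_diag pi ji pij; have pji := partner_neq0 pi ji pij.
  by rewrite (partner_sym pj ij pji) (partner_sgr pi ji pij).
move=> x; pose w := x - x i *: e i - x j *: e j.
have wi : w i = 0.
  by rewrite !c0B !c0Z !c0_unitE eqxx (negbTE ij) mulr1 mulr0 subrr subr0.
have wj : w j = 0.
  by rewrite !c0B !c0Z !c0_unitE eqxx (negbTE ji) mulr1 mulr0 subr0 subrr.
pose t := `|w|; pose s' := Num.sg (P w i).
have s1' : `|s'| <= 1 by rewrite normr_sg; case: (_ == _).
(* On [v] the row takes the value [t / 2 + |P w i|], while [v] has norm at
   most [t] and vanishes at [i], which bounds this value by [t / 2]. *)
pose v := (t * s) *: e j + s' *: w.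
have vi : v i = 0 by rewrite c0D !c0Z c0_unitE (negbTE ij) wi !mulr0 addr0.
have v_le : `|v| <= t.
  rewrite c0_normE; apply: c0_norm_le => k; rewrite c0D !c0Z c0_unitE.
  have [->|kj] := eqVneq k j.
    by rewrite wj mulr0 addr0 mulr1 normrM s1 mulr1 normr_id.
  rewrite mulr0 add0r normrM (le_trans (ler_piMl _ _))//.
  exact: c0_coord_le.
have Pw0 : P w i = 0.
  have [+ _] := row_offdiag_le vi v_le.
  rewrite linearD !linearZZ c0D !c0Z -normrEsg pijE pi => /(le_trans (ler_norm _)).
  have -> : t * s * (s / 2) = t / 2.
    by rewrite mulrA -(mulrA t) -[s * s]expr2 /s sqr_sg pij mulr1.
  move=> h; apply/eqP; rewrite -normr_le0; lra.
have /(congr1 (fun u => P u i)) : x = w + x j *: e j + x i *: e i.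
  by rewrite /w !subrK.
rewrite 2!linearD !linearZZ 2!c0D !c0Z Pw0 add0r pi pijE => ->; lra.
Qed.

(** In other words the reflection [2 P - I] sends [x] to a sequence with [i]-th
coordinate [s * x j] and [j]-th coordinate [s * x i].  The diagonal values 0
and 1 are the cases where [j = i], with [s = -1] and [s = 1]. *)
Lemma bicontractive_rows i : exists j (s : R), `|s| = 1 /\
  forall x, P x i = (x i + s * x j) / 2 /\ P x j = (x j + s * x i) / 2.
Proof.
have trivial_row : p i i = 0 \/ p i i = 1 -> exists (s : R), `|s| = 1 /\
    forall x, P x i = (x i + s * x i) / 2.
  (* This is the diagonal entry of [2 P - I]. *)
  move=> pi; exists (2 * p i i - 1); split.
    by case: pi => ->; rewrite ?mulr0 ?mulr1 ?sub0r ?normrN1// addrK normr1.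
  move=> x; rewrite row_trivial; first by lra.
  by case: pi => ->; rewrite ?mul0r// subrr mulr0.
have [p0|p1|pi] := diag_values i.
- by have [|s [s1 Px]] := trivial_row; [left|exists i, s; split].
- by have [|s [s1 Px]] := trivial_row; [right|exists i, s; split].
have [j ji pij] := row_partner pi; have ij : i != j by rewrite eq_sym.
exists j, (Num.sg (p i j)); split; first by rewrite normr_sg pij.
have pj := partner_diag pi ji pij; have pji := partner_neq0 pi ji pij.
move=> x; split; first exact: row_pair.
by rewrite (row_pair pj ij pji) (partner_sgr pi ji pij).
Qed.

End bicontractive_projections.

Section bicontractive_ranges.
Context (R : realType) (P : {linear c0 R -> c0 R}) (Z : submodClosed (c0 R)).
Hypothesis PZ : forall x, P x \in Z.
Hypothesis fixZ : forall x, x \in Z -> P x = x.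
Hypothesis contrP : forall x, `|P x| <= `|x|.
Hypothesis contrIP : forall x, `|x - P x| <= `|x|.

Local Notation e := (c0_unit R).
Local Notation p i j := (P (e j) i).
Implicit Types (i j k : nat) (x : c0 R).

Let PP x : P (P x) = P x. Proof. exact: fixZ. Qed.
Let rows := bicontractive_rows PP contrP contrIP.

Lemma entry_sym i j : p i j = p j i.
Proof.
have half k l : k != l -> p k l != 0 -> p l k = p k l.
  have [m [s [_ rowsE]]] := rows k; have [-> _] := rowsE (e l).
  rewrite !c0_unitE => /negbTE kl; rewrite kl add0r.
  have [mE|_] := eqVneq m l; last by rewrite mulr0 mul0r eqxx.
  rewrite mE in rowsE; have [_ ->] := rowsE (e k).
  by rewrite !c0_unitE !eqxx [l == k]eq_sym kl !add0r.
have [->//|ij] := eqVneq i j.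
have [pij|/(half _ _ ij)//] := eqVneq (p i j) 0.
have [->//|/half] := eqVneq (p j i) 0.
by rewrite eq_sym => /(_ ij).
Qed.

(** One index from each orbit of the signed permutation [2 P - I] on which the
range of [P] does not vanish: the least one, as the nonzero entries of column
[i] lie in the orbit of [i]. *)
Definition leaders : {pred nat} :=
  [pred i | (p i i != 0) && [forall k : 'I_i, p k i == 0]].

Lemma leadersP i : reflect (p i i != 0 /\ forall k, (k < i)%N -> p k i = 0)
  (i \in leaders).
Proof.
apply: (iffP andP) => -[pi low]; split => //.
  by move=> k ki; apply/eqP; have /forallP/(_ (Ordinal ki)) := low.
by apply/forallP => k; apply/eqP/low.
Qed.

Lemma leaders_entry i k : i \in leaders -> k \in leaders -> k != i -> p k i = 0.
Proof.
move=> /leadersP[_ lowi] /leadersP[_ lowk]; rewrite neq_ltn => /orP[/lowi//|ik].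
by rewrite entry_sym lowk.
Qed.

(** If [i] is not a leader, either row [i] is zero, or [i] is paired with a
smaller leader [j] and then [x i] and [x j] agree up to sign. *)
Lemma leaders_dominate x (M : R) : x \in Z -> 0 <= M ->
  (forall i, i \in leaders -> `|x i| <= M) -> forall i, `|x i| <= M.
Proof.
move=> xZ M0 xM i; have [/xM//|] := boolP (i \in leaders).
have [pi _|pi] := eqVneq (p i i) 0.
  rewrite -(fixZ xZ) (row_trivial contrP contrIP) pi ?mul0r//.
  by rewrite normr0.
rewrite inE pi/= negb_forall => /existsP[k].
rewrite entry_sym; have [j [s [s1 rowsE]]] := rows i.
have [-> _] := rowsE (e k); have ik := ltn_ord k.
rewrite c0_unitE (gtn_eqF ik) add0r c0_unitE.
have [jk _|_] := eqVneq j k; last by rewrite mulr0 mul0r eqxx.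
have [xi _] := rowsE x; rewrite fixZ// in xi.
have -> : x i = s * x j by lra.
rewrite normrM s1 mul1r; apply: xM; apply/leadersP.
have rowj l : (l <= j)%N -> p j l = (j == l)%:R / 2.
  move=> lj; have [_ ->] := rowsE (e l).
  rewrite !c0_unitE [i == l]gtn_eqF ?mulr0 ?addr0//.
  by rewrite (leq_ltn_trans lj)// jk.
split=> [|l lj]; first by rewrite rowj// eqxx mul1r invr_eq0 pnatr_eq0.
by rewrite entry_sym rowj 1?ltnW// gtn_eqF// mul0r.
Qed.

(** Restricting sequences to the leaders keeps their norms, and the normalised
column [(p n n)^-1 *: P (e n)] restricts to the unit vector [e n]. *)
Lemma bicontractive_range_L1_predual : L1_predual (subspace_of Z).
Proof.
pose T : {linear subspace_of Z -> c0 R} :=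
  [the {linear _ -> _} of c0_mask leaders \o val].
have PbZ n : (p n n)^-1 *: P (e n) \in Z by rewrite rpredZ.
pose b n : subspace_of Z := exist (fun x => x \in Z) _ (PbZ n).
apply: (@c0_copy_L1_predual R _ leaders T b).
- move=> x; apply/le_anti/andP; split; rewrite subspace_normE c0_normE.
    apply: c0_norm_le => n; rewrite c0_maskE.
    by case: ifP => _; [exact: c0_coord_le|rewrite normr0].
  apply: c0_norm_le; apply: leaders_dominate => [||n nA].
  - exact: valP.
  - exact: c0_norm_ge0.
  by have := c0_coord_le (T x) n; rewrite c0_maskE nA.
- by move=> x n nA; rewrite c0_maskE (negbTE nA).
- move=> n nA; apply: c0_ext => k; rewrite c0_unitE.
  have -> : T (b n) k = if k \in leaders then (p n n)^-1 * p k n else 0 by [].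
  have [->|kn] := eqVneq k n.
    by rewrite nA mulVf//; have /leadersP[] := nA.
  by case: ifP => // kA; rewrite (leaders_entry nA kA kn) mulr0.
Qed.

End bicontractive_ranges.

(** * From unique extensions and a bicontractive projection to property HB *)

Section duality_with_subspaces.
Context (R : realType) (X : normedModType R) (Y : submodClosed X).

Lemma incl_subproof : (val : subspace_of Y -> X) \in blin_pred _ _.
Proof. by apply: contraction_in_blin_pred. Qed.

Definition incl : blin (subspace_of Y) X := Blin incl_subproof.

Lemma incl_norm : `|incl| <= 1.
Proof. by rewrite blin_normE; apply: opnorm_le. Qed.

Lemma blin_restriction_norm (f : dual X) :
  `|blin_comp f incl : dual (subspace_of Y)| <= `|f|.
Proof.
by rewrite (le_trans (blin_comp_norm _ _))// ler_piMr// incl_norm.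
Qed.

Variables (P : blin X X).
Hypothesis PY : forall x, P x \in Y.

Definition corestr x : subspace_of Y := exist (fun x => x \in Y) (P x) (PY x).

Lemma corestr_subproof : corestr \in blin_pred _ _.
Proof.
apply: (@bounded_in_blin_pred _ _ _ _ `|P|) => [a x y|x]; last exact: opnorm_ub.
by apply/val_inj; rewrite /= linearP.
Qed.

Definition blin_corestr : blin X (subspace_of Y) := Blin corestr_subproof.

Lemma blin_corestrE x : val (blin_corestr x) = P x. Proof. by []. Qed.

End duality_with_subspaces.

Section bicontractive_gives_HB.
Context (R : realType) (X : normedModType R) (Y : submodClosed X).
Variable P : blin X X.

Definition adjoint_fixed_pred : {pred dual X} := [pred f | adjoint P f == f].

Lemma adjoint_fixed_submod_closed : submod_closed adjoint_fixed_pred.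
Proof.
split=> [|a f g /eqP Pf /eqP Pg]; apply/eqP; first exact: linear0.
by rewrite linearP/= Pf Pg.
Qed.

HB.instance Definition _ := GRing.isSubmodClosed.Build R (dual X)
  adjoint_fixed_pred adjoint_fixed_submod_closed.

Definition adjoint_fixed : submodClosed (dual X) := adjoint_fixed_pred.

Lemma adjoint_fixedP (f : dual X) : f \in adjoint_fixed <-> adjoint P f = f.
Proof. by split => /eqP. Qed.

Lemma adjoint_fixed_closed : closed [set` adjoint_fixed].
Proof.
move=> f clf; apply/adjoint_fixedP/eqP; rewrite -subr_eq0 -normr_le0.
apply/ler_addgt0Pr => e e0; rewrite add0r.
have c_gt0 : 0 < `|P| + 1 by rewrite ltr_wpDl.
have [h [/= /adjoint_fixedP hP]] := clf _ (nbhsx_ballx f _ (divr_gt0 e0 c_gt0)).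
rewrite -ball_normE /= => /ltW fh.
have -> : adjoint P f - f = adjoint P (f - h) - (f - h).
  by rewrite linearB/= hP opprB addrA subrK.
rewrite (le_trans (ler_normB _ _))// (le_trans (lerD (adjoint_norm _ _) (lexx _)))//.
rewrite -[X in _ + X]mulr1 -mulrDr (le_trans (ler_wpM2r (ltW c_gt0) fh))//.
by rewrite divfK ?gt_eqF.
Qed.

(** The complement of the annihilator is the range of the adjoint of [P],
described as the set of functionals that the adjoint fixes. *)
Lemma property_U_bicontractive_HB :
  projection_onto P Y -> bicontractive P -> property_U Y -> property_HB Y.
Proof.
move=> [PP rP] [P1 Q1] UY.
have PY x : P x \in Y.
  by have : range P (P x) by [exists x]; rewrite rP.
have fixY y : y \in Y -> P y = y.
  by move=> yY; have : [set` Y] y by []; rewrite -rP => -[x _ <-]; exact: PP.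
(* Functionals in the annihilator of [Y] are killed by the adjoint, so the
   component along the complement is always given by composition with [P]. *)
have compP (g h : dual X) : g \in adjoint_fixed -> annihilator Y h ->
    adjoint P (g + h) = g.
  move=> /adjoint_fixedP gP hY; apply: blin_ext => x.
  by rewrite -{2}gP !adjointE [(g + h) _](_ : _ = g (P x) + h (P x))// hY// addr0.
have in_range (f : dual X) : adjoint P f \in adjoint_fixed.
  by apply/adjoint_fixedP; apply: blin_ext => x; rewrite !adjointE PP.
exists adjoint_fixed; split.
- exact: adjoint_fixed_closed.
- move=> f; exists (adjoint P f, f - adjoint P f); split.
    split => /=; [exact: in_range| |by rewrite addrC subrK].
    by move=> y yY; rewrite [LHS](_ : _ = f y - f (P y))// fixY// subrr.
  move=> [g h] [/= gG hY ->]; rewrite compP//.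
  by rewrite addrC addKr.
move=> _ g h gG hY h0 ->; set f := g + h.
have gE : g = adjoint P f by rewrite compP.
have hE : h = blin_comp f (blin_id X - P).
  apply: blin_ext => x; rewrite blin_compE.
  rewrite [(blin_id X - P) x](_ : _ = x - P x)//.
  have -> : f (x - P x) = f x - f (P x) by exact: linearB.
  have -> : f (P x) = g x by rewrite [in RHS]gE.
  by rewrite [f x](_ : _ = g x + h x)// addrAC subrr add0r.
split; last first.
  by rewrite hE (le_trans (blin_comp_norm _ _))// ler_piMr.
rewrite lt_neqAle; apply/andP; split; last first.
  by rewrite gE (le_trans (adjoint_norm _ _))// ler_piMr.
(* If the norms of [f] and [f \o P] agree, both extend [r] with its norm. *)
apply: contra h0 => /eqP gf.
pose r : dual (subspace_of Y) := blin_comp f (incl Y).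
have gr : `|g| <= `|r|.
  have -> : g = blin_comp r (blin_corestr PY) by rewrite gE; apply: blin_ext.
  by rewrite (le_trans (blin_comp_norm _ _))// ler_piMr.
have fr : `|f| = `|r|.
  by apply/le_anti; rewrite -{1}gf gr blin_restriction_norm.
have [k [_ kuniq]] := UY r.
have kf : k = f by apply: kuniq.
have kg : k = g.
  apply: kuniq; split; last by rewrite gf.
  by move=> y; rewrite gE adjointE fixY//; exact: valP.
by rewrite -(addKr g h) -/f -kf kg addNr.
Qed.

End bicontractive_gives_HB.

(** * From property HB to a bicontractive projection and unique extensions *)

Section finite_rank.
Context (R : realType) (W : normedModType R).
Implicit Types s : seq (dual W * W).

Definition finite_rank s (x : W) : W :=
  \sum_(p <- s) p.1 x *: p.2.

Lemma finite_rank_linear s :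
  linear (finite_rank s).
Proof.
move=> a x y; rewrite /finite_rank scaler_sumr -big_split/=.
by apply: eq_bigr => p _; rewrite linearP scalerDl scalerA.
Qed.

HB.instance Definition _ s :=
  GRing.isLinear.Build R W W *:%R (finite_rank s) (finite_rank_linear s).

Lemma finite_rank_subproof s :
  finite_rank s \in blin_pred W W.
Proof.
apply: (@bounded_in_blin_pred _ _ _ _ (\sum_(p <- s) `|p.1| * `|p.2|)).
  exact: finite_rank_linear.
move=> x; rewrite (le_trans (ler_norm_sum _ _ _))// mulr_suml ler_sum// => p _.
by rewrite normrZ mulrAC ler_wpM2r// opnorm_ub.
Qed.

Definition blin_finite_rank s :
  blin W W := Blin (finite_rank_subproof s).

Lemma finite_rank_adjoint s (f : dual W) :
  adjoint (blin_finite_rank s) f = \sum_(p <- s) f p.2 *: p.1.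
Proof.
apply: blin_ext => x; rewrite blin_compE /= /finite_rank linear_sum/=.
by elim/big_ind2: _ => // [_ a _ b -> ->//|p _]; rewrite dualZ mulrC.
Qed.

End finite_rank.

Section finite_dimensional_subspaces.
Context (R : realType).

(** Induction on the list: the new vector [b] leaves a residue
[r = b - finite_rank s b]; if it is nonzero, some coordinate functional
rescaled to take the value 1 at [r] and made to vanish on the span of the
previous vectors gives the missing rank one term.  Coordinates play here the
part of the Hahn-Banach theorem. *)
Lemma finite_rank_identity (bs : seq (c0 R)) (Y : submodClosed (c0 R)) :
  {subset bs <= Y} -> exists s, (forall p, p \in s -> p.2 \in Y) /\
    {in bs, forall b, finite_rank s b = b}.
Proof.
elim: bs => [|b bs IH] bsY; first by exists [::].
have [|s [sY sbs]] := IH.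
  by move=> x xbs; apply: bsY; rewrite inE xbs orbT.
pose r := b - finite_rank s b.
have rY : r \in Y.
  rewrite /r -scaleN1r; apply: rpredD; first by apply: bsY; rewrite inE eqxx.
  apply: rpredZ; rewrite /finite_rank big_seq; apply: rpred_sum => p /sY pY.
  exact: rpredZ.
have [r0|r0] := eqVneq r 0.
  exists s; split => // x; rewrite inE => /orP[/eqP ->|/sbs//].
  by apply/eqP; rewrite eq_sym -subr_eq0 -/r r0.
have [n rn] : exists n, r n != 0.
  apply: contrapT => rn; move/eqP: r0; apply; apply: c0_ext => n.
  by apply: contrapT => /eqP rn0; apply: rn; exists n.
pose psi : dual (c0 R) := (r n)^-1 *: c0_coord R n.
(* Where [finite_rank s] is the identity, [phi] vanishes. *)
pose phi : dual (c0 R) := psi - adjoint (blin_finite_rank s) psi.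
have phiE x : phi x = psi (x - finite_rank s x) by rewrite linearB.
exists ((phi, r) :: s); split=> [p|x]; rewrite inE.
  by move=> /orP[/eqP ->//|/sY].
have -> : finite_rank ((phi, r) :: s) x = phi x *: r + finite_rank s x.
  by rewrite /finite_rank big_cons.
rewrite phiE => /orP[/eqP ->|/sbs xs]; last first.
  by rewrite xs subrr linear0 scale0r add0r.
have -> : psi (b - finite_rank s b) = 1.
  by rewrite -/r [LHS](_ : _ = (r n)^-1 * r n)// mulVf.
by rewrite scale1r subrK.
Qed.

Lemma finite_dimensional_identity (Y : submodClosed (c0 R)) :
  finite_dimensional Y -> exists s, (forall p, p \in s -> p.2 \in Y) /\
    {in Y, forall y, finite_rank s y = y}.
Proof.
move=> [n [b Yb]].
have bY i : b i \in Y.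
  apply/Yb; exists (fun j => (j == i)%:R); rewrite (bigD1 i)//= eqxx scale1r.
  by rewrite big1 ?addr0// => j /negbTE ->; rewrite scale0r.
have [|s [sY sb]] := @finite_rank_identity (codom b) Y.
  by move=> _ /codomP[i ->].
exists s; split => // y /Yb[c ->]; rewrite linear_sum; apply: eq_bigr => i _.
by rewrite linearZZ /= sb ?codom_f.
Qed.

(** Each functional in a finite rank form of the identity of [Y] is replaced by
its component in [G], which has the same restriction to [Y].  The adjoint then
takes values in the span of these components. *)
Lemma HB_projection (Y : submodClosed (c0 R)) (G : submodClosed (dual (c0 R))) :
  finite_dimensional Y ->
  (forall f : dual (c0 R), exists! gh : dual (c0 R) * dual (c0 R),
    [/\ gh.1 \in G, annihilator Y gh.2 & f = gh.1 + gh.2]) ->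
  exists P : blin (c0 R) (c0 R), [/\ forall x, P x \in Y,
    forall y, y \in Y -> P y = y & forall f : dual (c0 R), adjoint P f \in G].
Proof.
move=> /finite_dimensional_identity[s [sY sid]] GY.
have Q_ex (f : dual (c0 R)) : exists g : dual (c0 R),
    g \in G /\ annihilator Y (f - g).
  have [[g h] [[/= gG hY fE] _]] := GY f.
  by exists g; rewrite fE addrC addKr.
have [Q QG] := choice Q_ex.
pose t := [seq (Q p.1, p.2) | p <- s].
exists (blin_finite_rank t); split => [x|y yY|f].
- rewrite /= /finite_rank big_map big_seq rpred_sum// => p /sY pY.
  exact: rpredZ.
- rewrite /= /finite_rank big_map -[RHS]sid//; apply: eq_bigr => p _ /=.
  have [_ /(_ y yY)] := QG p.1; rewrite [_ y](_ : _ = p.1 y - Q p.1 y)//.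
  by move=> /eqP; rewrite subr_eq0 => /eqP <-.
- rewrite finite_rank_adjoint big_map rpred_sum// => p _; apply: rpredZ.
  by have [] := QG p.1.
Qed.

End finite_dimensional_subspaces.

Section HB_gives_U.
Context (R : realType) (X : normedModType R) (Y : submodClosed X).
Variables (P : blin X X) (G : submodClosed (dual X)).
Hypothesis PY : forall x, P x \in Y.
Hypothesis fixY : forall y, y \in Y -> P y = y.
Hypothesis PG : forall f : dual X, adjoint P f \in G.
Hypothesis normG : forall f g h : dual X,
  g \in G -> annihilator Y h -> h != 0 -> f = g + h ->
  `|g| < `|f| /\ `|h| <= `|f|.

Lemma adjoint_compl_annihilator f : annihilator Y (f - adjoint P f).
Proof.
move=> y yY; rewrite [LHS](_ : _ = f y - f (P y))//.
by rewrite fixY// subrr.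
Qed.

Lemma adjoint_le (f : dual X) : `|adjoint P f| <= `|f|.
Proof.
have [/eqP|fP] := eqVneq (f - adjoint P f) 0.
  by rewrite subr_eq0 => /eqP {2}->.
by have [/ltW] := normG (PG f) (@adjoint_compl_annihilator f) fP (esym (subrKC _ _)).
Qed.

Lemma adjoint_compl_le (f : dual X) : `|f - adjoint P f| <= `|f|.
Proof.
have [->|fP] := eqVneq (f - adjoint P f) 0; first by rewrite normr0.
by have [] := normG (PG f) (@adjoint_compl_annihilator f) fP (esym (subrKC _ _)).
Qed.

(** The extension is [r \o P].  Any norm-preserving extension [g] has
[r \o P] as its component in [G]; were the other component nonzero, [r \o P]
would be an extension of [r] of norm smaller than that of [r]. *)
Lemma HB_property_U : `|P| <= 1 -> property_U Y.
Proof.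
move=> P1 r; pose f : dual X := blin_comp r (blin_corestr PY).
have fr y : f (val y) = r y.
  rewrite blin_compE; congr (r _); apply/val_inj; rewrite blin_corestrE fixY//.
  exact: valP.
have norm_ext (g : dual X) : (forall y, g (val y) = r y) -> `|r| <= `|g|.
  move=> gr; have -> : r = blin_comp g (incl Y).
    by apply: blin_ext => y; rewrite -gr.
  exact: blin_restriction_norm.
have f_le : `|f| <= `|r|.
  by rewrite (le_trans (blin_comp_norm _ _))// ler_piMr.
exists f; split; first by split=> //; apply/le_anti; rewrite f_le norm_ext.
move=> g [gr normg].
have gP : adjoint P g = f.
  by apply: blin_ext => x; rewrite [RHS]blin_compE -gr blin_corestrE.
have [/eqP|gf] := eqVneq (g - f) 0; first by rewrite subr_eq0 => /eqP ->.
have [] := normG (PG g) (@adjoint_compl_annihilator g) _ (esym (subrKC _ _)).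
  by rewrite gP.
by rewrite gP normg ltNge norm_ext.
Qed.

End HB_gives_U.

(** * The equivalence *)

Theorem theorem3p3 (R : realType) (Y : submodClosed (c0 R))
    (finY : finite_dimensional Y) :
  property_HB Y <->
  property_U Y /\
  exists P : blin (c0 R) (c0 R),
    [/\ projection_onto P Y,
        bicontractive P,
        L1_predual (subspace_of Y) &
        L1_predual (subspace_of (brange (blin_id (c0 R) - P)))].
Proof.
split=> [[G [_ GY normG]]|[UY [P [projP bicP _ _]]]]; last first.
  exact: property_U_bicontractive_HB projP bicP UY.
have [P [PY fixY PG]] := HB_projection finY GY.
have contrP : forall x, `|P x| <= `|x|.
  by apply: adjoint_contraction => f; apply: adjoint_le fixY PG normG f.
have contrIP x : `|x - P x| <= `|x|.
  apply: (@adjoint_contraction _ (blin_id (c0 R) - P)) => f.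
  have -> : adjoint (blin_id (c0 R) - P) f = f - adjoint P f.
    by apply: blin_ext => z; rewrite adjointE linearB.
  exact: adjoint_compl_le fixY PG normG f.
have P1 : `|P| <= 1.
  by rewrite blin_normE; apply: opnorm_le => x; apply: le_trans.
split; first exact: HB_property_U P1.
exists P; split.
- split=> [x|]; first exact/fixY/PY.
  apply/seteqP; split => [_ [x _ <-]|y yY]; first exact: PY.
  by exists y => //; exact: fixY.
- split=> //; rewrite blin_normE; apply: opnorm_le => x.
  exact: le_trans (contrIP x).
- exact: bicontractive_range_L1_predual PY fixY contrP contrIP.
- apply: (@bicontractive_range_L1_predual _ (blin_id (c0 R) - P)).
  + by move=> x; apply/asboolP; exists x.
  + move=> _ /asboolP[x _ <-].
    rewrite [LHS](_ : _ = (x - P x) - P (x - P x))// linearB/=.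
    by rewrite (fixY (P x))// subrr subr0.
  + exact: contrIP.
  + by move=> x; rewrite [x - _](_ : _ = x - (x - P x))// opprB addrC subrK.
Qed.
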